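(* Let $L\subset\mathbb{Z}^n$ be a non-positive lattice. There exists a basis of $L_{pure}$ (as a $\mathbb{Z}$-module) whose elements are in $L^+$ and have support equal to $\sigma$.
   Context: Let $\mathbb{N}=\mathbb{Z}_{\ge0}$. A lattice is a subgroup $L\subset\mathbb{Z}^n$; it is non-positive if $L\cap\mathbb{N}^n\neq\{\mathbf 0\}$. $L^+=L\cap\mathbb{N}^n$; $L_{pure}$ is the subgroup of $L$ generated by $L^+$. The support of $w\in\mathbb{Z}^n$ is $\operatorname{supp}(w)=\{i:w_i\ne0\}$, and $\sigma=\bigcup_{w\in L^+}\operatorname{supp}(w)$. *)

(* Defs.v *)
From HB Require Import structures.
From mathcomp Require Import all_boot all_order all_algebra.
From mathcomp Require Import boolp classical_sets.

Set Implicit Arguments.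
Unset Strict Implicit.
Unset Printing Implicit Defensive.

Import Order.TTheory GRing.Theory Num.Theory.
Local Open Scope classical_set_scope.
Local Open Scope ring_scope.

Definition lattice n (L : set 'rV[int]_n) : Prop := zmod_closed (mem L).

Definition positive_part n (L : set 'rV[int]_n) : set 'rV[int]_n :=
  L `&` [set v : 'rV[int]_n | forall i, 0 <= v 0 i].

(* Despite the name: [L] does contain a nonzero vector with nonnegative entries. *)
Definition nonpositive_lattice n (L : set 'rV[int]_n) : Prop :=
  positive_part L <> [set 0].

(* [smallest] is the intersection of all subgroups containing the given set,
   i.e. the subgroup it generates. *)
Definition pure_part n (L : set 'rV[int]_n) : set 'rV[int]_n :=
  smallest (@lattice n) (positive_part L).

Definition supp n (w : 'rV[int]_n) : set 'I_n := [set i | w 0 i != 0].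

Definition support_union n (L : set 'rV[int]_n) : set 'I_n :=
  \bigcup_(w in positive_part L) supp w.

Definition Zfree n r (b : 'I_r -> 'rV[int]_n) : Prop :=
  forall a : 'I_r -> int, \sum_i a i *: b i = 0 -> forall i, a i = 0.

Definition Zspan n r (b : 'I_r -> 'rV[int]_n) : set 'rV[int]_n :=
  [set v | exists a : 'I_r -> int, v = \sum_i a i *: b i].

Definition Zbasis n r (M : set 'rV[int]_n) (b : 'I_r -> 'rV[int]_n) : Prop :=
  Zfree b /\ Zspan b = M.

(* Main.v *)
Require Import Defs.
From HB Require Import structures.
From mathcomp Require Import all_boot all_order all_algebra.
From mathcomp Require Import boolp classical_sets.
From mathcomp Require Import ring lra.

Set Implicit Arguments.
Unset Strict Implicit.
Unset Printing Implicit Defensive.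

Import Order.TTheory GRing.Theory Num.Theory.
Local Open Scope classical_set_scope.
Local Open Scope ring_scope.

(** Write [M] for the pure part of [L].  Adding up elements of [L^+], one for
    each index of the support union, gives [w] in [L^+] of full support.  The
    vectors of [M] parallel to [w] form an infinite cyclic group, generated by
    some [w1] of which [w] is a positive multiple ([parallel_generator]); so
    [w1] is again in [L^+] and has full support.  The quotient of [M] by
    [Z w1] is free, hence [w1] together with arbitrary lifts of a basis of the
    quotient is a basis of [M] ([lift_Zbasis]).  A lift may be changed by any
    multiple of [w1], and vectors of [M] vanish outside the support union
    ([pure_part_eq0]), so adding a large multiple of [w1] makes every lift
    nonnegative and of full support ([exists_positive_shift]).

    The quotient is realised inside [Z^n]: for an index [i] with [w_i != 0],
    the map [v |-> w_i v - v_i w] kills exactly the vectors parallel to [w].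
    Its values have [i]-th coordinate zero, so the same map, iterated, also
    shows that subgroups of [Z^n] are free ([lattice_free]). *)

(** * Subgroups of Z^n *)

Section Lattice.
Variables (n : nat) (M : set 'rV[int]_n).

Lemma latticeP :
  lattice M <-> M 0 /\ (forall u v, M u -> M v -> M (u - v)).
Proof.
split=> -[M0 MB]; split.
- by move: M0; rewrite inE.
- by move=> u v Mu Mv; have /[!inE] := MB u v (mem_set Mu) (mem_set Mv).
- by rewrite inE.
- by move=> u v /set_mem Mu /set_mem Mv; rewrite inE; exact: MB.
Qed.

Hypothesis latM : lattice M.

Lemma lattice0 : M 0.
Proof. by case/latticeP: latM. Qed.

Lemma latticeB u v : M u -> M v -> M (u - v).
Proof. by case/latticeP: latM => _; apply. Qed.

Lemma latticeN u : M u -> M (- u).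
Proof. by move=> Mu; rewrite -sub0r; apply: latticeB => //; exact: lattice0. Qed.

Lemma latticeD u v : M u -> M v -> M (u + v).
Proof. by move=> Mu Mv; rewrite -[v]opprK; apply/latticeB/latticeN. Qed.

Lemma latticeZ (a : int) u : M u -> M (a *: u).
Proof.
move=> Mu; rewrite -[a]intz scaler_int.
have MMn m : M (u *+ m).
  by elim: m => [|m IHm]; [exact: lattice0 | rewrite mulrS; exact: latticeD].
by case: a => m; [exact: MMn | exact/latticeN/MMn].
Qed.

Lemma lattice_sum (I : Type) (s : seq I) (F : I -> 'rV[int]_n) :
  (forall i, M (F i)) -> M (\sum_(i <- s) F i).
Proof. by move=> MF; apply: big_ind => //; [exact: lattice0|exact: latticeD]. Qed.

Lemma Zbasis_mem r (b : 'I_r -> 'rV[int]_n) i : Zbasis M b -> M (b i).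
Proof.
move=> [_ <-]; exists (fun j => (j == i)%:R).
rewrite (bigD1 i) //= eqxx scale1r big1 ?addr0 // => j /negPf->.
by rewrite scale0r.
Qed.

End Lattice.

(** * Eliminating a coordinate *)

Section Eliminate.
Variables (n : nat) (M : set 'rV[int]_n) (w : 'rV[int]_n) (i0 : 'I_n).
Hypotheses (latM : lattice M) (Mw : M w) (wi0 : w 0 i0 != 0).

Definition eliminate (v : 'rV[int]_n) := w 0 i0 *: v - v 0 i0 *: w.

Lemma eliminate_is_linear : linear eliminate.
Proof.
move=> a u v; apply/rowP => j; rewrite /eliminate !mxE; ring.
Qed.

HB.instance Definition _ :=
  GRing.isLinear.Build int 'rV[int]_n 'rV[int]_n *:%R eliminate
    eliminate_is_linear.

Lemma eliminate_pivot v : eliminate v 0 i0 = 0.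
Proof. rewrite /eliminate !mxE; ring. Qed.

Lemma eliminate_image_lattice : lattice (eliminate @` M).
Proof.
apply/latticeP; split; first by exists 0; [exact: lattice0|rewrite linear0].
move=> _ _ [u Mu <-] [v Mv <-]; exists (u - v); last by rewrite linearB.
exact: latticeB.
Qed.

Lemma eliminate_kernel_inj v : eliminate v = 0 -> v 0 i0 = 0 -> v = 0.
Proof.
move=> /rowP ev vi0; apply/rowP => j; move/eqP: (ev j).
by rewrite /eliminate vi0 scale0r subr0 !mxE mulf_eq0 (negPf wi0) => /eqP.
Qed.

(** Among the vectors of [M] parallel to [w], one minimising the positive value
    of [w_{i0} v_{i0}] divides all the others, by Euclidean division of these
    values.  Measuring by this product rather than by [|v_{i0}|] selects the
    generator that points in the same direction as [w]. *)
Lemma parallel_generator :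
  exists w1, [/\ M w1, eliminate w1 = 0, w1 0 i0 != 0,
    (forall v, M v -> eliminate v = 0 -> exists a : int, v = a *: w1)
    & exists2 g : int, 0 < g & w = g *: w1].
Proof.
(* The values of w_{i0} v_{i0} to be minimised, [v = w] being a candidate. *)
pose good m := `[< exists v, [/\ M v, eliminate v = 0,
  w 0 i0 * v 0 i0 = m%:Z & (0 < m)%N] >].
have [|m /asboolP[w1 [Mw1 ew1 wm m_gt0]] m_min] := @ex_minnP good.
  exists `|(w 0 i0 * w 0 i0)%R|%N; apply/asboolP; exists w; split=> //.
  - by rewrite /eliminate subrr.
  - by rewrite gez0_abs // -expr2 sqr_ge0.
  - by rewrite absz_gt0 mulf_neq0.
have w1i0 : w1 0 i0 != 0.
  by apply: contraTneq m_gt0 => w10; move: wm; rewrite w10 mulr0 => -[<-].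
have gen v : M v -> eliminate v = 0 -> exists a : int, v = a *: w1.
  move=> Mv ev; pose x := w 0 i0 * v 0 i0; pose q := (x %/ m)%Z; exists q.
  apply/eqP; rewrite -subr_eq0; apply/eqP.
  have er : eliminate (v - q *: w1) = 0.
    by rewrite linearB linearZ /= ev ew1 scaler0 subrr.
  have rE : w 0 i0 * (v - q *: w1) 0 i0 = (x %% m)%Z.
    rewrite /modz -/q -wm !mxE /x; ring.
  apply: eliminate_kernel_inj => //; apply/eqP/contraT => r_neq0.
  have m_neq0 : m%:Z != 0 by rewrite eqz_nat -lt0n.
  have r_ge0 := modz_ge0 x m_neq0.
  have : (m <= `|(x %% m)%Z|)%N.
    apply: m_min; apply/asboolP; exists (v - q *: w1); split => //.
    - by apply: latticeB => //; exact: latticeZ.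
    - by rewrite gez0_abs.
    - by rewrite -rE absz_gt0 mulf_neq0.
  by rewrite -lez_nat gez0_abs // leNgt ltz_pmod.
have [|g wE] := gen w Mw; first by rewrite /eliminate subrr.
exists w1; split=> //; exists g => //.
have : 0 < w 0 i0 * w1 0 i0 by rewrite wm.
by rewrite wE mxE -mulrA -expr2 pmulr_lgt0 // exprn_even_gt0.
Qed.

Lemma exists_lift r (d : 'I_r -> 'rV[int]_n) :
    Zbasis (eliminate @` M) d ->
  exists c, forall j, M (c j) /\ eliminate (c j) = d j.
Proof.
move=> dP.
suff /choice[c cP] : forall j, exists v, M v /\ eliminate v = d j by exists c.
by move=> j; have [v Mv <-] := Zbasis_mem j dP; exists v.
Qed.

(** Splitting of the exact sequence
    [0 -> Z w1 -> M -> eliminate @` M -> 0].  The lifts [c] of the basis [d]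
    are arbitrary, which leaves the freedom to choose them positive. *)
Lemma lift_Zbasis r (d c : 'I_r -> 'rV[int]_n) w1 :
    M w1 -> eliminate w1 = 0 -> w1 0 i0 != 0 ->
    (forall v, M v -> eliminate v = 0 -> exists a : int, v = a *: w1) ->
    Zbasis (eliminate @` M) d ->
    (forall j, M (c j)) -> (forall j, eliminate (c j) = d j) ->
  Zbasis M (fun i : 'I_r.+1 => oapp c w1 (unlift ord0 i)).
Proof.
move=> Mw1 ew1 w1i0 gen [d_free d_span] Mc ec; split=> [a|].
  rewrite big_ord_recl unlift_none /=.
  under eq_bigr do rewrite liftK /=.
  move=> sum0.
  have a_lift j : a (lift ord0 j) = 0.
    apply: (d_free (fun j => a (lift ord0 j))).
    have := congr1 eliminate sum0.
    rewrite linearD linearZ /= ew1 scaler0 add0r linear0 linear_sum => sum0'.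
    by rewrite -[RHS]sum0'; apply: eq_bigr => k _; rewrite linearZ /= ec.
  have a0 : a ord0 = 0.
    move: sum0; rewrite big1 => [|k _]; last by rewrite a_lift scale0r.
    rewrite addr0 => /rowP/(_ i0)/eqP.
    by rewrite !mxE mulf_eq0 (negPf w1i0) orbF => /eqP.
  by move=> i; case: (unliftP ord0 i) => [j|] ->.
apply/seteqP; split=> [_ [a ->]|v Mv].
  apply: lattice_sum => // i; apply: latticeZ => //.
  by case: (unliftP ord0 i) => [j|] _ /=.
have : Zspan d (eliminate v) by rewrite d_span; exists v.
case=> a evE; pose u := \sum_j a j *: c j.
have [||a0 a0E] := gen (v - u).
- apply: latticeB => //; apply: lattice_sum => // j; exact: latticeZ.
- rewrite linearB linear_sum /= evE -sumrB big1 // => j _.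
  by rewrite linearZ /= ec subrr.
exists (fun i => oapp a a0 (unlift ord0 i)).
rewrite big_ord_recl unlift_none /= -a0E.
under eq_bigr do rewrite liftK /=.
by rewrite subrK.
Qed.

End Eliminate.

(** The induction is on the number of coordinates at which vectors of [M] may
    be nonzero: eliminating with respect to a nonzero vector of [M] frees one
    such coordinate, at the cost of one basis vector. *)
Lemma lattice_free_on n (A : {set 'I_n}) (M : set 'rV[int]_n) :
    lattice M -> (forall v, M v -> forall i, i \notin A -> v 0 i = 0) ->
  exists r (b : 'I_r -> 'rV[int]_n), Zbasis M b.
Proof.
have [k] := ubnP #|A|; elim: k => // k IHk in A M *.
rewrite ltnS => cardA latM suppM.
have [[w [Mw w_neq0]]|M0] := pselect (exists w, M w /\ w != 0); last first.
  exists 0, (fun=> 0); split=> [a _ []//|].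
  apply/seteqP; split=> [_ [a ->]|v Mv].
    by rewrite big_ord0; exact: lattice0.
  exists (fun=> 0); rewrite big_ord0; apply/eqP/contraT => v_neq0.
  by case: M0; exists v.
have /rV0Pn[i wi] := w_neq0.
have iA : i \in A by apply: contraNT wi => /(suppM w Mw)/eqP.
have [w1 [Mw1 ew1 w1i gen _]] := parallel_generator latM Mw wi.
have [|||r [d dP]] := IHk (A :\ i)%SET (eliminate w i @` M).
- by rewrite (leq_trans _ cardA) // [X in (_ < X)%N](cardsD1 i) iA.
- exact: eliminate_image_lattice.
- move=> _ [v Mv <-] j; rewrite !inE negb_and negbK => /orP[/eqP->|jA].
    exact: eliminate_pivot.
  by rewrite /eliminate !mxE !(suppM _ _ j) // !mulr0 subrr.
have [c cP] := exists_lift dP.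
exists r.+1; eexists; apply: (lift_Zbasis (c := c) latM Mw1 ew1 w1i gen dP) => j.
  by case: (cP j).
by case: (cP j).
Qed.

Lemma lattice_free n (M : set 'rV[int]_n) :
  lattice M -> exists r (b : 'I_r -> 'rV[int]_n), Zbasis M b.
Proof.
by move=> latM; apply: (@lattice_free_on _ [set: _]%SET) => // v _ i; rewrite inE.
Qed.

(** * The pure part *)

Section PurePart.
Variables (n : nat) (L : set 'rV[int]_n).
Hypothesis latL : lattice L.

Lemma pure_part_lattice : lattice (pure_part L).
Proof.
apply/latticeP; split=> [M [latM _]|u v Mu Mv M LM]; first exact: lattice0.
by apply: latticeB; [case: LM|exact: Mu|exact: Mv].
Qed.

Lemma positive_sub_pure : positive_part L `<=` pure_part L.
Proof. by move=> v Lv M [_]; apply. Qed.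

Lemma pure_sub : pure_part L `<=` L.
Proof. by move=> v; apply; split=> // u []. Qed.

(** Vanishing at [i] defines a subgroup, and it contains [L^+]. *)
Lemma pure_part_eq0 v i : pure_part L v -> ~ support_union L i -> v 0 i = 0.
Proof.
move=> Mv Ni; apply: (Mv [set u | u 0 i = 0]); split.
  apply/latticeP; split=> /= [|u u' ui u'i]; first by rewrite mxE.
  by rewrite !mxE ui u'i subrr.
by move=> u Lu /=; apply/eqP/contraT => ui; case: Ni; exists u.
Qed.

(** Positivity on the support union is all that has to be checked on the
    vectors of the basis: off it the coordinates are zero anyway. *)
Lemma pure_full_support v :
    pure_part L v -> (forall i, support_union L i -> 0 < v 0 i) ->
  positive_part L v /\ supp v = support_union L.
Proof.
move=> Mv v_gt0; split.
  split=> [|i /=]; first exact: pure_sub.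
  by have [/v_gt0/ltW//|/(pure_part_eq0 Mv)->] := pselect (support_union L i).
apply/seteqP; split=> i /=; last by move/v_gt0; rewrite /supp /= lt0r => /andP[].
rewrite /supp /= => vi; apply: contrapT => Ni.
by rewrite (pure_part_eq0 Mv Ni) eqxx in vi.
Qed.

Lemma exists_full_support :
  exists2 w, positive_part L w & forall i, support_union L i -> 0 < w 0 i.
Proof.
have /choice[f fP] : forall i, exists u : 'rV[int]_n,
    positive_part L u /\ (support_union L i -> 0 < u 0 i).
  move=> i; have [[u Lu ui]|Ni] := pselect (support_union L i).
    by exists u; split=> // _; rewrite lt0r; apply/andP; split=> //; case: Lu.
  by exists 0; split=> //; split=> [|j /=]; [exact: lattice0|rewrite mxE].
exists (\sum_i f i) => [|i Si].
  split=> [|j /=]; first by apply: lattice_sum => // i; case: (fP i) => -[].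
  by rewrite summxE sumr_ge0 // => i _; case: (fP i) => -[_ /(_ j)].
rewrite summxE (bigD1 i) //= ltr_pwDl //; first by case: (fP i) => _; apply.
by apply: sumr_ge0 => j _; case: (fP j) => -[_ /(_ i)].
Qed.

End PurePart.

(** * Bases of full support *)

Lemma exists_positive_shift n (S : set 'I_n) (u v : 'rV[int]_n) :
    (forall i, S i -> 0 < u 0 i) ->
  exists N : int, forall i, S i -> 0 < (v + N *: u) 0 i.
Proof.
move=> u_gt0; exists (1 + \sum_i `|v 0 i|) => i /u_gt0 ui; rewrite !mxE.
have v_le : `|v 0 i| <= \sum_j `|v 0 j|.
  by rewrite (bigD1 i) //= lerDl sumr_ge0.
have N_ge : 0 <= 1 + \sum_j `|v 0 j| by rewrite addr_ge0 // sumr_ge0.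
have : (1 + \sum_j `|v 0 j|) * 1 <= (1 + \sum_j `|v 0 j|) * u 0 i.
  by rewrite ler_wpM2l // -gtz0_ge1.
by have := ler_norm (- v 0 i); rewrite normrN; lra.
Qed.

Theorem corollary2p14 (n : nat) (L : set 'rV[int]_n)
    (hL : lattice L) (hpos : nonpositive_lattice L) :
  exists (r : nat) (b : 'I_r -> 'rV[int]_n),
    Zbasis (pure_part L) b /\
    (forall i : 'I_r,
       positive_part L (b i) /\ supp (b i) = support_union L).
Proof.
have latM := pure_part_lattice L.
have [w Lw w_gt0] := exists_full_support hL.
have [i Si] : exists i, support_union L i.
  apply: contrapT => S0; apply: hpos; apply/seteqP; split=> [v Lv|_ ->].
    apply/rowP => i; rewrite mxE.
    by apply: (pure_part_eq0 (positive_sub_pure Lv)) => Si; apply: S0; exists i.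
  by split=> [|j /=]; [exact: lattice0|rewrite mxE].
have wi : w 0 i != 0 by rewrite gt_eqF // w_gt0.
have [w1 [Mw1 ew1 w1i gen [g g_gt0 wE]]] :=
  parallel_generator latM (positive_sub_pure Lw) wi.
have w1_gt0 j : support_union L j -> 0 < w1 0 j.
  by move/w_gt0; rewrite wE mxE pmulr_rgt0.
have [r [d dP]] := lattice_free (eliminate_image_lattice w i latM).
have [c cP] := exists_lift dP.
have [N NP] := choice (fun j => exists_positive_shift (c j) w1_gt0).
(* Still lifts of [d], since the elimination map kills [w1]. *)
pose c' j := c j + N j *: w1.
have Mc' j : pure_part L (c' j).
  by apply: (latticeD latM); [case: (cP j)|exact: (latticeZ latM)].
exists r.+1, (fun k => oapp c' w1 (unlift ord0 k)); split.
  apply: (lift_Zbasis (c := c') latM Mw1 ew1 w1i gen dP) => // j.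
  by rewrite linearD linearZ /= ew1 scaler0 addr0; case: (cP j).
move=> k; case: (unliftP ord0 k) => [j|] _ /=; apply: pure_full_support => //.
exact: NP.
Qed.
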